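(* Let $C$ be a smooth projective curve of genus $2$ defined over $\mathbb{Q}$, and assume that $C$ has exactly two $\mathbb{Q}$-rational Weierstrass points and a quadratic Weierstrass point. If $C$ is described by a globally minimal Weierstrass equation of the form $E:\ y^2+Q(x)y=P(x)$ with $P,Q\in\mathbb{Z}[x]$, $\deg Q(x)\le 2$ and $P(x)$ monic of degree $5$, then $|\Delta_E|$ is never an odd prime.
   Context: A Weierstrass equation of a genus two curve $C$ over $\mathbb{Q}$ is an equation $y^2+Q(x)y=P(x)$ with $P,Q\in\mathbb{Q}[x]$, $\deg Q\le 3$, $\deg P\le 6$, such that $x$ generates the subfield of $\mathbb{Q}(C)$ fixed by the hyperelliptic involution and $\mathbb{Q}(C)=\mathbb{Q}(x)[y]$. Its discriminant is $\Delta_E=2^{-12}\operatorname{disc}(4P(x)+Q(x)^2)$. A Weierstrass equation is integral if $P,Q\in\mathbb{Z}[x]$; it is minimal at a prime $p$ if it is integral and the $p$-adic valuation of its discriminant is smallest among all integral Weierstrass equations describing $C$ over $\mathbb{Z}_p$; it is globally minimal if it is minimal at every prime. Weierstrass points of $C$ are the fixed points of the hyperelliptic involution; $\mathbb{Q}$-rational ones are those defined over $\mathbb{Q}$, and a quadratic Weierstrass point is one defined over a quadratic extension of $\mathbb{Q}$ but not over $\mathbb{Q}$ (equivalently, in a model $y^2=xF(x)$ with $F$ monic quartic, $F$ is a product of two irreducible quadratics over $\mathbb{Q}$). *)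

(* Defs.v *)
From HB Require Import structures.
From mathcomp Require Import all_boot all_order all_algebra all_field.
Set Implicit Arguments. Unset Strict Implicit. Unset Printing Implicit Defensive.
Import Order.TTheory GRing.Theory Num.Theory.
Local Open Scope ring_scope.

Definition polyQ (p : {poly int}) : {poly rat} := map_poly (fun z : int => z%:~R) p.

(* Discriminant of F viewed as a binary form of degree 6 (a sextic):
   disc_6 F = -Res(F,F')/a6 if deg F = 6 ;
   disc_6 F = a5^2 * disc_5 F = a5 * Res(F,F') if deg F = 5 ;
   disc_6 F = 0 if deg F <= 4 (repeated root at infinity). *)
Definition disc6 (F : {poly rat}) : rat :=
  if size F == 7%N then - resultant F F^`() / lead_coef F
  else if size F == 6%N then lead_coef F * resultant F F^`()
  else 0.

Definition discE (P Q : {poly rat}) : rat :=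
  (2%:R ^- 12) * disc6 (4%:R *: P + Q ^+ 2).

Definition homsub (p : {poly rat}) (n : nat) (a b c d : rat) : {poly rat} :=
  \sum_(i < n.+1) p`_i *: ((a *: 'X + b%:P) ^+ i * (c *: 'X + d%:P) ^+ (n - i)).

(* The equation obtained from y^2 + Q y = P via
   x = (a x' + b)/(c x' + d),  y = (e y' + H(x'))/(c x' + d)^3 . *)
Definition wtrans (a b c d e : rat) (H P Q : {poly rat}) : {poly rat} * {poly rat} :=
  let Qt := homsub Q 3 a b c d in
  let Pt := homsub P 6 a b c d in
  (e ^- 2 *: (Pt - H ^+ 2 - Qt * H), e^-1 *: (2%:R *: H + Qt)).

Definition vp (p : nat) (r : rat) : int :=
  (logn p `|numq r|%N)%:Z - (logn p `|denq r|%N)%:Z.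

Definition pint (p : nat) (r : rat) : bool := ~~ (p %| `|denq r|%N)%N.

Definition poly_pint (p : nat) (f : {poly rat}) : Prop :=
  forall i : nat, pint p f`_i.

Definition minimal_at (p : nat) (P Q : {poly rat}) : Prop :=
  forall (a b c d e : rat) (H : {poly rat}),
    a * d - b * c != 0 -> e != 0 -> (size H <= 4)%N ->
    poly_pint p (wtrans a b c d e H P Q).1 ->
    poly_pint p (wtrans a b c d e H P Q).2 ->
    (vp p (discE P Q) <= vp p (discE (wtrans a b c d e H P Q).1
                                    (wtrans a b c d e H P Q).2))%R.

Definition globally_minimal (P Q : {poly rat}) : Prop :=
  forall p : nat, prime p -> minimal_at p P Q.

(* ---------- points of the smooth projective model in P(1,3,1) over Qbar ---------- *)
Definition pt := (algC * algC * algC)%type.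

Definition homC (f : {poly rat}) (n : nat) (X Z : algC) : algC :=
  \sum_(i < n.+1) ratr f`_i * X ^+ i * Z ^+ (n - i).

Definition on_curve (P Q : {poly rat}) (w : pt) : Prop :=
  let: (X, Y, Z) := w in
  w != (0, 0, 0) /\ Y ^+ 2 + homC Q 3 X Z * Y = homC P 6 X Z.

Definition wequiv (w w' : pt) : Prop :=
  let: (X, Y, Z) := w in let: (X', Y', Z') := w' in
  exists2 l : algC, l != 0 & [/\ X' = l * X, Y' = l ^+ 3 * Y & Z' = l * Z].

Definition hinv (Q : {poly rat}) (w : pt) : pt :=
  let: (X, Y, Z) := w in (X, - Y - homC Q 3 X Z, Z).

Definition weierstrass_pt (P Q : {poly rat}) (w : pt) : Prop :=
  on_curve P Q w /\ wequiv (hinv Q w) w.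

Definition defined_over (S : algC -> Prop) (w : pt) : Prop :=
  exists w' : pt, wequiv w w' /\
    let: (X, Y, Z) := w' in [/\ S X, S Y & S Z].

Definition inQ (x : algC) : Prop := x \in Crat.
(* Q(s) for s with s^2 rational: the quadratic (or trivial) extensions of Q *)
Definition inQs (s : algC) (x : algC) : Prop :=
  exists u v : rat, x = ratr u + ratr v * s.

Definition rational_pt (w : pt) : Prop := defined_over inQ w.

Definition quadratic_pt (w : pt) : Prop :=
  (exists s : algC, s ^+ 2 \in Crat /\ defined_over (inQs s) w) /\ ~ rational_pt w.

Definition exactly_two_rational_WP (P Q : {poly rat}) : Prop :=
  exists w1 w2 : pt,
    [/\ weierstrass_pt P Q w1 /\ rational_pt w1,
        weierstrass_pt P Q w2 /\ rational_pt w2,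
        ~ wequiv w1 w2 &
        forall w, weierstrass_pt P Q w -> rational_pt w -> wequiv w1 w \/ wequiv w2 w].

Definition has_quadratic_WP (P Q : {poly rat}) : Prop :=
  exists w : pt, weierstrass_pt P Q w /\ quadratic_pt w.

(* Main.v *)
Require Import Defs.
From HB Require Import structures.
From mathcomp Require Import all_boot all_order all_algebra all_field.
From mathcomp Require Import ring zify.
Set Implicit Arguments. Unset Strict Implicit. Unset Printing Implicit Defensive.
Import Order.TTheory GRing.Theory Num.Theory.
Local Open Scope ring_scope.

(** The finite Weierstrass points are the roots of the quintic [F = 4 P + Q ^ 2],
    of leading coefficient 4.  The second rational Weierstrass point and the
    quadratic one give, by Gauss's lemma, a factorization
    [F = (al x - be) q1 q2] over the integers, and [|Delta_E| = p] becomes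
      [disc q1 * disc q2 * Res(q1, q2) ^ 2 * (l1 * l2) ^ 2 = +- 2 ^ 8 * p],
    where [l_i] is the homogenized value of [q_i] at [be / al].  As [p] is odd,
    [l1], [l2], the resultant and one of the two discriminants are, up to sign,
    powers of 2.
    - A root [be / 4] with [be] odd forces [l_i = 1], so that [disc q_i] has the
      form [k (k + 1)]; being even it is divisible by 4, and neither discriminant
      can be a power of 2.
    - A root [be / 2] with [be] odd contradicts [F = Q ^ 2] modulo 4.
    - An integral root can be moved to 0; then [q1 q2 = x (a x + b) ^ 2] modulo 4,
      and in every parity class of the coefficients the power of 2 in the product
      is wrong, or a square would have to be one of 15, 17, 31, 33, 63, 65. *)

(** * Resultants as products over roots *)

(** The index pairs [i < j] split into those inside [s], those inside [r], and the mixed ones, where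
    the order condition holds automatically. *)
Lemma det_Vandermonde_row_mx (R : comNzRingType) m n (s : 'rV[R]_m) (r : 'rV[R]_n) :
  \det (Vandermonde (m + n) (row_mx s r)) =
  \det (Vandermonde m s) * \det (Vandermonde n r) *
  \prod_i \prod_j (r 0 j - s 0 i).
Proof.
rewrite !det_Vandermonde big_split_ord /=.
under eq_bigr => i _.
  rewrite big_split_ord /=.
  under eq_bigr do rewrite !row_mxEl.
  under [X in _ * X]eq_bigr do rewrite row_mxEl row_mxEr.
  rewrite [X in _ * X](eq_bigl xpredT); last first.
    by move=> j /=; rewrite (leq_trans (ltn_ord i)) ?leq_addr.
  over.
rewrite big_split /= -!mulrA; congr (_ * _); rewrite mulrC; congr (_ * _).
apply: eq_bigr => i _; rewrite big_split_ord /= big_pred0 ?mul1r; last first.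
  by move=> j /=; apply/negbTE; rewrite -leqNgt (leq_trans (ltnW (ltn_ord j))) ?leq_addr.
by apply: eq_big => [j | j _]; rewrite ?ltn_add2l ?row_mxEr.
Qed.

(** A row of the Sylvester matrix holds the shifted coefficients of [p] or [q]; against the powers
    of [x] it evaluates to [p.[x] * x ^+ i] or [q.[x] * x ^+ i]. The upper right block vanishes
    because the nodes [r] are roots of [p]. *)
Lemma Sylvester_mxM_Vandermonde (R : comNzRingType) (p q : {poly R})
    (s : 'rV[R]_((size q).-1)) (r : 'rV[R]_((size p).-1)) :
    (forall j, root p (r 0 j)) ->
  Sylvester_mx p q *m Vandermonde _ (row_mx s r) =
  block_mx (Vandermonde _ s *m diag_mx (\row_j p.[s 0 j])) 0
    (\matrix_(i, j) (q.[s 0 j] * s 0 j ^+ i))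
    (Vandermonde _ r *m diag_mx (\row_j q.[r 0 j])).
Proof.
move=> pr0.
have bandE (u : {poly R}) d m (i : 'I_m) (x : R) : ((size u).-1 + m <= d)%N ->
    \sum_(k < d) (u`_(k - i) *+ (i <= k)%N) * x ^+ k = u.[x] * x ^+ i.
  move=> le_d; rewrite -(hornerXn x i) -hornerM (horner_coef_wide x (n := d)).
    by apply: eq_bigr => k _; rewrite coefMXn ltnNge; case: leqP; rewrite ?mul0r.
  have [-> | u0] := eqVneq u 0; first by rewrite mul0r size_poly0.
  rewrite size_Mmonic ?monicXn // size_polyXn (leq_trans _ le_d) //.
  by move: u0 (ltn_ord i); rewrite -size_poly_gt0; lia.
apply/matrixP=> i j; rewrite -(splitK i) -(splitK j) mxE.
under eq_bigr => k _ do rewrite Sylvester_mxE splitK mxE.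
case: (split i) (split j) => [i1 | i1] [j1 | j1] /=.
- rewrite block_mxEul mul_mx_diag row_mxEl bandE 1?addnC // !mxE mulrC //.
- by rewrite block_mxEur row_mxEr bandE 1?addnC // mxE (eqP (pr0 j1)) mul0r.
- by rewrite block_mxEdl row_mxEl bandE // mxE.
- by rewrite block_mxEdr mul_mx_diag row_mxEr bandE // !mxE mulrC.
Qed.

(** Determinants are taken in the Sylvester-Vandermonde identity. Up to sign and powers of [c], the
    values of [p] at the auxiliary nodes [s] equal the mixed Vandermonde factor, so everything
    involving [s] cancels. *)
Lemma resultant_prod_roots (p q : {poly algC}) (c : algC) (rs : seq algC) :
    c != 0 -> uniq rs -> p = c *: \prod_(x <- rs) ('X - x%:P) ->
  resultant p q =
  (-1) ^+ (size rs * (size q).-1) * c ^+ (size q).-1 * \prod_(x <- rs) q.[x].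
Proof.
move=> c0 rs_uniq pE.
have szp : (size p).-1 = size rs by rewrite pE size_scale // size_prod_XsubC.
pose M := 1 + \sum_(x <- rs) `|x|.
(* Points distinct from each other and from the roots, so that the Vandermonde
   determinants below can be cancelled. *)
pose s : 'rV[algC]_(size q).-1 := \row_i (M + i%:R).
pose r : 'rV[algC]_(size p).-1 := \row_i nth 0 rs i.
have prod_rs (f : algC -> algC) : \prod_(x <- rs) f x = \prod_j f (r 0 j).
  by rewrite (big_nth 0) big_mkord -szp; apply: eq_bigr => j _; rewrite mxE.
have ps x : p.[x] = c * \prod_j (x - r 0 j).
  rewrite -(prod_rs (fun y => x - y)) {1}pE hornerZ horner_prod; congr (_ * _).
  by apply: eq_bigr => y _; rewrite hornerXsubC.
have pr0 j : root p (r 0 j).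
  by rewrite /root ps (bigD1 j) //= subrr mul0r mulr0.
have VN0 n (a : 'rV[algC]_n) : (forall i j : 'I_n, a 0 i = a 0 j -> i = j) ->
    \det (Vandermonde n a) != 0.
  move=> a_inj; rewrite det_Vandermonde; apply/prodf_neq0 => i _.
  apply/prodf_neq0 => j lt_ij; rewrite subr_eq0; apply/eqP => /a_inj ij.
  by rewrite ij ltnn in lt_ij.
have Vs : \det (Vandermonde _ s) != 0.
  apply: VN0 => i j; rewrite !mxE => /addrI/eqP; rewrite eqr_nat => /eqP.
  exact: val_inj.
have Vr : \det (Vandermonde _ r) != 0.
  apply: VN0 => i j; rewrite !mxE => /eqP.
  by rewrite nth_uniq -?szp // => /eqP; exact: val_inj.
(* Every node of [s] has modulus at least [M], and every root has modulus below [M]. *)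
have rs_neq i j : r 0 j - s 0 i != 0.
  rewrite subr_eq0; apply/eqP => rsE.
  have x_rs : r 0 j \in rs by rewrite mxE mem_nth -?szp.
  have : `|r 0 j| < M.
    rewrite /M (big_rem _ x_rs) /= addrCA ltrDl ltr_pwDl ?ltr01 //.
    by apply: sumr_ge0 => x _; exact: normr_ge0.
  rewrite rsE mxE ger0_norm; first by rewrite gtrDl le_gtF ?ler0n.
  by rewrite addr_ge0 ?ler0n // addr_ge0 ?ler01 // sumr_ge0.
have := congr1 determinant (Sylvester_mxM_Vandermonde s pr0).
rewrite det_mulmx det_lblock !det_mulmx !det_diag det_Vandermonde_row_mx.
have -> : \prod_i (\row_j p.[s 0 j]) 0 i = c ^+ (size q).-1 *
    ((-1) ^+ (size rs * (size q).-1) * \prod_i \prod_j (r 0 j - s 0 i)).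
  transitivity (\prod_i (c * ((-1) ^+ size rs * \prod_j (r 0 j - s 0 i)))).
    apply: eq_bigr => i _; rewrite mxE ps; congr (_ * _).
    transitivity (\prod_j (-1 * (r 0 j - s 0 i))).
      by apply: eq_bigr => j _; rewrite mulN1r opprB.
    by rewrite big_split /= prodr_const card_ord {1}szp.
  by rewrite !big_split /= !prodr_const card_ord -exprM.
have -> : \prod_i (\row_j q.[r 0 j]) 0 i = \prod_(x <- rs) q.[x].
  by rewrite prod_rs; apply: eq_bigr => i _; rewrite mxE.
rewrite -/(resultant p q).
set B := \det (Vandermonde _ s); set D := \det (Vandermonde _ r).
set E := \prod_i _; set G := \prod_(x <- _) _.
have E0 : E != 0 by apply/prodf_neq0 => i _; apply/prodf_neq0 => j _.
move=> H; have : B * D * E != 0 by rewrite !mulf_neq0.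
move/mulIf; apply; rewrite H; ring.
Qed.

(** * The discriminant of a factored quintic *)

Lemma resultant_map (F : fieldType) (R : nzRingType) (f : {rmorphism F -> R})
    (p q : {poly F}) :
  f (resultant p q) = resultant (map_poly f p) (map_poly f q).
Proof.
rewrite /resultant /Sylvester_mx !size_map_poly -det_map_mx /= map_col_mx.
congr (\det (col_mx _ _));
  by apply: map_lin1_mx => v; rewrite map_poly_rV rmorphM /= map_rVpoly.
Qed.

Definition quad (R : nzRingType) (a b c : R) : {poly R} :=
  a *: 'X^2 + b *: 'X + c%:P.

Definition qdisc (R : nzRingType) (a b c : R) : R := b ^+ 2 - 4 * a * c.

(** Closed form of the resultant of the two quadratics. *)
Definition qres (R : nzRingType) (a b c a' b' c' : R) : R :=
  (a * c' - a' * c) ^+ 2 - (a * b' - a' * b) * (b * c' - b' * c).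

(* [al ^+ 2] times the value of [quad a b c] at [be / al]. *)
Definition lres (R : nzRingType) (al be a b c : R) : R :=
  a * be ^+ 2 + b * al * be + c * al ^+ 2.

(** The degree 5 discriminant of [(al x - be) q1 q2], by the rule disc(f g) = disc(f) disc(g) Res(f,
    g)^2; the factors [lres] are the resultants with the linear form. *)
Definition quintic_disc (R : nzRingType) (al be a b c a' b' c' : R) : R :=
  qdisc a b c * qdisc a' b' c' * qres a b c a' b' c' ^+ 2 *
  (lres al be a b c * lres al be a' b' c') ^+ 2.

Lemma rmorph_quintic_disc (R S : nzRingType) (f : {rmorphism R -> S})
    (al be a b c a' b' c' : R) :
  f (quintic_disc al be a b c a' b' c') =
  quintic_disc (f al) (f be) (f a) (f b) (f c) (f a') (f b') (f c').
Proof.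
by rewrite /quintic_disc /lres /qres /qdisc
  !(rmorph_nat, rmorphXn, rmorphM, rmorphB, rmorphD).
Qed.

Lemma quad_split (a b c : algC) : a != 0 ->
  exists x y, [/\ b = - a * (x + y), c = a * (x * y) &
    quad a b c = a *: (('X - x%:P) * ('X - y%:P))].
Proof.
move=> a0; pose s := sqrtC (b ^+ 2 - 4 * a * c).
have sE : s ^+ 2 = b ^+ 2 - 4 * a * c by exact: sqrtCK.
pose x := (- b + s) / (2 * a); pose y := (- b - s) / (2 * a).
have bE : b = - a * (x + y) by rewrite /x /y; field.
have cE : c = a * (x * y).
  have -> : x * y = (b ^+ 2 - s ^+ 2) / (4 * a ^+ 2) by rewrite /x /y; field.
  by rewrite sE; field.
exists x, y; split=> //; clearbody x y.
rewrite /quad bE cE -!mul_polyC !(polyCM, polyCN, polyCD); ring.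
Qed.

Lemma deriv_prod_XsubC_root (R : comNzRingType) (k x : R) (s t : seq R) :
    perm_eq s (x :: t) ->
  (k *: \prod_(y <- s) ('X - y%:P))^`().[x] = k * \prod_(y <- t) (x - y).
Proof.
move=> /(perm_big _) -> /=; rewrite big_cons derivZ derivM derivXsubC mul1r hornerZ.
rewrite hornerD hornerM hornerXsubC subrr mul0r addr0 horner_prod.
by congr (_ * _); apply: eq_bigr => y _; rewrite hornerXsubC.
Qed.

(** Both sides are compared over [algC] as products of differences of roots. Nonvanishing of
    [disc6 F] makes the five roots distinct, so that the resultant with the derivative is a product
    over them. *)
Lemma disc6_quintic (al be a b c a' b' c' : rat) :
    al != 0 -> a != 0 -> a' != 0 ->
    let F := (al *: 'X - be%:P) * quad a b c * quad a' b' c' in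
    disc6 F != 0 ->
  disc6 F = (al * a * a') ^+ 2 * quintic_disc al be a b c a' b' c'.
Proof.
move=> al0 a0 a'0 F; set k := al * a * a'.
have k0 : k != 0 by rewrite !mulf_neq0.
pose f : rat -> algC := ratr; pose Fc := map_poly ratr F : {poly algC}.
have fk : f k = f al * f a * f a' by rewrite /f /k !rmorphM.
have f0 u : u != 0 -> f u != 0 by rewrite fmorph_eq0.
have mq u v w : map_poly ratr (quad u v w) = quad (f u) (f v) (f w).
  by rewrite /quad !rmorphD /= !map_polyZ map_polyC map_polyXn map_polyX.
have [x1 [x2 [b_E c_E q_E]]] := quad_split (f b) (f c) (f0 _ a0).
have [y1 [y2 [b'_E c'_E q'_E]]] := quad_split (f b') (f c') (f0 _ a'0).
pose z := f be / f al.
have zE : f be = f al * z by rewrite mulrC divfK ?f0.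
clearbody z; pose rs := [:: z; x1; x2; y1; y2].
have FcE : Fc = f k *: \prod_(x <- rs) ('X - x%:P).
  rewrite /Fc /F !rmorphM /= !mq q_E q'_E rmorphB /= map_polyZ map_polyC map_polyX /=.
  rewrite -/f zE !big_cons big_nil -!mul_polyC.
  by rewrite (polyCM (f al) z) fk (polyCM (f al * f a)) (polyCM (f al)); ring.
have szF : size F = 6%N.
  by rewrite -(size_map_poly (@ratr algC)) -/Fc FcE size_scale ?f0 // size_prod_XsubC.
have F0 : F != 0 by rewrite -size_poly_gt0 szF.
have lF : lead_coef F = k.
  apply: (fmorph_inj (@ratr algC)); rewrite -lead_coef_map -/Fc FcE lead_coefZ.
  by rewrite (monicP (monic_prod_XsubC _ _ _)) mulr1.
rewrite /disc6 szF /= lF mulf_eq0 (negPf k0) /= => res0.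
(* A nonzero resultant makes [F] coprime to its derivative, hence separable. *)
have rs_uniq : uniq rs.
  rewrite -separable_prod_XsubC.
  have /eqp_separable <- : Fc %= \prod_(x <- rs) ('X - x%:P) by rewrite FcE eqp_scale ?f0.
  rewrite separable_map unlock coprimep_def.
  rewrite resultant_eq0 -leqNgt in res0; rewrite eqn_leq res0 /=.
  by rewrite size_poly_gt0 gcdp_eq0 negb_and F0.
have : f (resultant F F^`()) = f k ^+ 4 * \prod_(x <- rs) Fc^`().[x].
  rewrite {1}/f resultant_map -deriv_map -/Fc (resultant_prod_roots _ (f0 _ k0) rs_uniq FcE).
  (* The derivative has degree exactly 4, its top coefficient being [5 k]; the sign exponent 5 * 4
     is then even. *)
  have -> : (size Fc^`()).-1 = 4%N.
    rewrite deriv_map size_map_poly; suff -> : size F^`() = 5%N by [].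
    apply/eqP; rewrite eqn_leq -ltnS -{1}szF lt_size_deriv //=.
    rewrite ltnNge; apply: contra k0 => /leq_sizeP /(_ 4%N (leqnn _)) /eqP.
    by rewrite coef_deriv mulrn_eq0 /= -lF /lead_coef szF.
  by rewrite -signr_odd /= mul1r.
pose m (x y1 y2 y3 y4 : algC) := f k * ((x - y1) * (x - y2) * (x - y3) * (x - y4)).
have -> : \prod_(x <- rs) Fc^`().[x] = m z x1 x2 y1 y2 * m x1 z x2 y1 y2 *
    m x2 z x1 y1 y2 * m y1 z x1 x2 y2 * m y2 z x1 x2 y1.
  have mE x u1 u2 u3 u4 : perm_eq rs [:: x; u1; u2; u3; u4] -> Fc^`().[x] = m x u1 u2 u3 u4.
    by rewrite FcE => /deriv_prod_XsubC_root ->; rewrite !big_cons big_nil /m; ring.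
  rewrite (big_cons _ _ z) !(big_cons _ _ _ _ xpredT) big_nil.
  rewrite (mE z x1 x2 y1 y2) // (mE x1 z x2 y1 y2) ?(mE x2 z x1 y1 y2) ?(mE y1 z x1 x2 y2)
    ?(mE y2 z x1 x2 y1) ?mulr1 ?mulrA //; by apply/permP => P /=; ring.
move=> resE; apply: (fmorph_inj (@ratr algC)).
transitivity (f k * f (resultant F F^`())); first by rewrite /f rmorphM.
rewrite {}resE.
rewrite [RHS](_ : _ =
    f k ^+ 2 * quintic_disc (f al) (f be) (f a) (f b) (f c) (f a') (f b') (f c')); last first.
  by rewrite /f -(rmorph_quintic_disc (@ratr algC)) -rmorphXn -rmorphM.
rewrite fk zE b_E c_E b'_E c'_E /quintic_disc.
have dE (u x y : algC) : qdisc u (- u * (x + y)) (u * (x * y)) = - (u ^+ 2 * (x - y) * (y - x)).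
  by rewrite /qdisc; ring.
have lE (u v x y : algC) : 
    lres u (u * z) v (- v * (x + y)) (v * (x * y)) = u ^+ 2 * v * (z - x) * (z - y).
  by rewrite /lres; ring.
have rE (u v s1 s2 t1 t2 : algC) :
    qres u (- u * (s1 + s2)) (u * (s1 * s2)) v (- v * (t1 + t2)) (v * (t1 * t2)) =
    u ^+ 2 * v ^+ 2 * ((s1 - t1) * (s1 - t2) * (s2 - t1) * (s2 - t2)).
  by rewrite /qres; ring.
rewrite !dE !lE rE /m -/(f k) fk.
(* Each pair of roots is given a single orientation, leaving ten independent differences. *)
rewrite -(opprB z x1) -(opprB z x2) -(opprB z y1) -(opprB z y2) -(opprB x1 x2) -(opprB y1 y2).
rewrite -(opprB x1 y1) -(opprB x1 y2) -(opprB x2 y1) -(opprB x2 y2).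
(* Without these generalizations [ring] expands a product of twenty differences. *)
move: (z - x1) (z - x2) (z - y1) (z - y2) (x1 - x2) (y1 - y2)
  (x1 - y1) (x1 - y2) (x2 - y1) (x2 - y2) (f al) (f a) (f a').
move=> d1 d2 d3 d4 d5 d6 d7 d8 d9 d10 e1 e2 e3; ring.
Qed.

(** * Arithmetic of the factored discriminant *)

(** If [p] divided both factors, [p ^ 2] would divide [2 ^ n * p]. So one factor is coprime to [p],
    and that one divides [2 ^ n]. *)
Lemma dvdn_pow2_or n p a b : prime p -> odd p -> (a * b %| 2 ^ n * p)%N ->
  (a %| 2 ^ n)%N \/ (b %| 2 ^ n)%N.
Proof.
move=> p_pr p_odd dvd_ab.
have co2 : coprime p (2 ^ n) by rewrite coprime_sym coprimeXl // coprime2n.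
have p_gt0 := prime_gt0 p_pr.
case: (boolP (coprime a p)) => [co_a | nco_a].
  by left; rewrite -(Gauss_dvdl _ co_a) (dvdn_trans (dvdn_mulr b (dvdnn a))).
right; case: (boolP (coprime b p)) => [co_b | nco_b].
  by rewrite -(Gauss_dvdl _ co_b) (dvdn_trans (dvdn_mull a (dvdnn b))).
have pa : (p %| a)%N by move: nco_a; rewrite coprime_sym prime_coprime // negbK.
have pb : (p %| b)%N by move: nco_b; rewrite coprime_sym prime_coprime // negbK.
have := dvdn_trans (dvdn_mul pa pb) dvd_ab; rewrite dvdn_pmul2r // => p2.
by have := gcdn_idPl p2; rewrite (eqP co2) => p1; rewrite -p1 in p_pr.
Qed.

(** The listed values are [2 ^ k - 1] and [2 ^ k + 1] for k = 4, 5, 6: those that the square [b ^ 2]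
    would take if an odd discriminant were 1 or -1. *)
Lemma sqr_neq (x n : int) :
  n \in [:: 15; 17; 31; 33; 63; 65] \/ n < 0 -> x ^+ 2 <> n.
Proof.
move=> nE xn; case: nE; last by rewrite -xn ltNge sqr_ge0.
rewrite -{n}xn -(real_normK (num_real x)) -abszE; move: `|x|%N => m; case: (ltnP m 9) => [|m9].
  by do 9!case: m => [|m] //.
have : 81 <= m%:Z ^+ 2 by nia.
by rewrite !inE; lia.
Qed.

Definition evz (x : int) : bool := (2 %| x)%Z.

Lemma evzP x : evz x -> exists y, x = 2 * y.
Proof. by move=> /dvdzP[y ->]; exists y; rewrite mulrC. Qed.

Lemma oddzP x : ~~ evz x -> exists y, x = 2 * y + 1.
Proof. rewrite /evz => xo; exists (x %/ 2)%Z; lia. Qed.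

Lemma evzM x y : evz (x * y) = evz x || evz y.
Proof. by rewrite /evz !dvdzE abszM Euclid_dvdM. Qed.

Lemma evzD x y : evz (x + y) = (evz x == evz y).
Proof. rewrite /evz; lia. Qed.

Lemma evzN x : evz (- x) = evz x.
Proof. rewrite /evz; lia. Qed.

Lemma evz_nat (n : nat) : evz n%:R = ~~ odd n.
Proof. by rewrite /evz pmulrn intz; lia. Qed.

Definition evzE := (expr2, evz_nat, evzD, evzN, evzM).

Lemma odd_dvd_pow2 x n : ~~ evz x -> (`|x|%N %| 2 ^ n)%N -> x = 1 \/ x = - 1.
Proof.
move=> xo /(dvdn_pfactor _ _ (isT : prime 2)) [[|m] _ xE]; first by lia.
by move: xo; rewrite /evz dvdzE xE expnS dvdn_mulr.
Qed.

Section PrimeTimesPow2.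

Variable P : int.
Hypotheses (P_prime : prime `|P|%N) (P_odd : ~~ evz P).

Let p_odd : odd `|P|%N.
Proof. by move: P_odd; rewrite /evz; lia. Qed.

(** Here [P] is an odd prime up to sign, since the discriminant may be negative. *)
Lemma dvd_pow2_or n x y M : x * y * M = 2 ^+ n * P ->
  (`|x|%N %| 2 ^ n)%N \/ (`|y|%N %| 2 ^ n)%N.
Proof.
move=> xyM; apply: (dvdn_pow2_or P_prime p_odd).
by have := congr1 absz xyM; rewrite !abszM abszX => <-; rewrite dvdn_mulr.
Qed.

Lemma sqr_dvd_pow2 n x M : x ^+ 2 * M = 2 ^+ n * P -> (`|x|%N %| 2 ^ n)%N.
Proof. by rewrite expr2 => /dvd_pow2_or[]. Qed.

Lemma odd_sqr_dvd n x M : ~~ evz x -> x ^+ 2 * M = 2 ^+ n * P -> x = 1 \/ x = - 1.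
Proof. by move=> xo /sqr_dvd_pow2/(odd_dvd_pow2 xo). Qed.

Lemma odd_cancel4 (x y z : int) : ~~ evz x -> x * y = 4 * z -> exists t, y = 4 * t.
Proof.
move=> /oddzP[k ->] xy; have : evz ((2 * k + 1) * y) by rewrite xy evzM.
by rewrite !evzE /= => /evzP[y' yE]; exists (z - k * y'); lia.
Qed.

(** Closes every case in which the product contains more than eight factors 2. *)
Lemma neq_512M x : 512 * x <> 256 * P.
Proof. move: P_odd; rewrite /evz; lia. Qed.

(** The case of leading coefficients 4 and 1, split by the parities of [b1], [b], [c1] and [c2]. *)
Lemma no_lead_4_1 (b1 c1 b2 c2 a b u v w t : int) :
    4 * b2 + 1 * b1 = 4 * u + a ^+ 2 ->
    4 * c2 + b1 * b2 + c1 * 1 = 4 * v + 2 * (a * b) ->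
    b1 * c2 + b2 * c1 = 4 * w + b ^+ 2 ->
    c1 * c2 = 4 * t ->
    qdisc 4 b1 c1 * qdisc 1 b2 c2 * qres 4 b1 c1 1 b2 c2 ^+ 2 * (c1 * c2) ^+ 2 = 256 * P ->
  False.
Proof.
move=> g3 g2 g1 g0 N.
have no512 x : qdisc 4 b1 c1 * qdisc 1 b2 c2 * qres 4 b1 c1 1 b2 c2 ^+ 2 *
    (c1 * c2) ^+ 2 <> 512 * x.
  by rewrite N => /esym/neq_512M.
rewrite /qdisc /qres in no512.
(* For [b1] even, 4 divides every coefficient of the first quadratic, and [2 ^ 16] divides the
   product. *)
case: (boolP (evz b1)) => [/evzP[b1' b1E] | b1o].
  have : evz (a ^+ 2) by have := congr1 evz g3; rewrite b1E !evzE /=.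
  rewrite expr2 evzM orbb => /evzP[a' aE].
  have [b1'' b1''E] : exists b1'', b1 = 4 * b1''.
    by exists (u + a' * a' - b2); clear -g3 aE; lia.
  have [c1' c1'E] : exists c1', c1 = 4 * c1'.
    by exists (v + a' * b - c2 - b1'' * b2); clear -g2 aE b1''E; lia.
  apply: (no512 (128 * (b1'' ^+ 2 - 4 * c1') * (b2 ^+ 2 - 4 * c2) *
     ((c2 - c1') ^+ 2 - (b2 - b1'') * (b1'' * c2 - b2 * c1')) ^+ 2 * (c1' * c2) ^+ 2)).
  by rewrite b1''E c1'E; ring.
have ao : ~~ evz a.
  by have := congr1 evz g3; rewrite !evzE (negPf b1o) /=; case: (evz a).
have D1o : ~~ evz (b1 ^+ 2 - 4 * 4 * c1) by rewrite !evzE (negPf b1o).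
case: (boolP (evz b)) => [/evzP[b' bE] | bo].
  case: (boolP (evz c1)) => [/evzP[c1' c1E] | c1o]; last first.
    have [c2' c2E] := odd_cancel4 c1o g0.
    have := congr1 evz g1; have := congr1 evz g2.
    by rewrite c2E bE !evzE (negPf b1o) (negPf c1o) /=; case: (evz b2).
  have : evz b2 by have := congr1 evz g2; rewrite c1E !evzE (negPf b1o) /=; case: (evz b2).
  move=> /evzP[b2' b2E].
  have c1'b2' : b1 * b2' + c1' = 2 * (v + a * b' - c2) by clear -g2 bE b2E c1E; lia.
  have [c2' c2E] : exists c2', c2 = 4 * c2'.
    have : b1 * c2 = 4 * (w + b' * b' - b2' * c1') by clear -g1 bE b2E c1E; lia.
    exact: odd_cancel4.
  (* In both subcases [2 ^ 12] divides the product. *)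
  case: (boolP (evz c1')) => [/evzP[c1'' c1'E] | c1'o].
    have : evz b2' by have := congr1 evz c1'b2'; rewrite c1'E !evzE (negPf b1o) /=; case: (evz b2').
    move=> /evzP[b2'' b2'E].
    apply: (no512 (8 * (b1 ^+ 2 - 16 * c1) * (b2'' ^+ 2 - c2') *
      ((4 * c2 - c1) ^+ 2 - (4 * b2 - b1) * (b1 * c2 - b2 * c1)) ^+ 2 * (c1'' * c2') ^+ 2)).
    by rewrite b2E b2'E c1E c1'E c2E; ring.
  apply: (no512 (8 * (b1 ^+ 2 - 32 * c1') * (b2' ^+ 2 - 4 * c2') *
    ((8 * c2' - c1') ^+ 2 - (8 * b2' - b1) * (b1 * c2' - b2' * c1')) ^+ 2 * (c1' * c2') ^+ 2)).
  by rewrite b2E c1E c2E; ring.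
have b1c2 : evz c2 <> (evz b2 || evz c1).
  have := congr1 evz g1; rewrite !evzE (negPf b1o) (negPf bo) /=.
  by case: (evz c2) (evz b2) (evz c1) => [] [] [].
(* For [c2] even, both discriminants are odd; after removing [c1], which is 1 or -1, and 64, the
   product is [4 * P]. Hence one discriminant is 1 or -1, which no square [b1 ^ 2] or [b2 ^ 2]
   allows. *)
case: (boolP (evz c2)) => c2e.
  have [b2o c1o] : ~~ evz b2 /\ ~~ evz c1.
    by move: b1c2; rewrite c2e; case: (evz b2) (evz c1) => [] [].
  have [c2' c2E] : exists c2', c2 = 4 * c2' by exact: odd_cancel4 g0.
  have : evz ((4 * c2 - c1) ^+ 2 - (4 * b2 - b1) * (b1 * c2 - b2 * c1)).
    by rewrite c2E !evzE (negPf b1o) (negPf b2o) (negPf c1o).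
  move=> /evzP[R' RE].
  have c1E : c1 = 1 \/ c1 = -1.
    apply: (@odd_sqr_dvd 8 c1
      (qdisc 4 b1 c1 * qdisc 1 b2 c2 * qres 4 b1 c1 1 b2 c2 ^+ 2 * c2 ^+ 2) c1o).
    by rewrite [RHS](_ : _ = 256 * P) // -N; ring.
  have c1c1 : c1 * c1 = 1 by case: c1E => ->.
  have {}N : qdisc 4 b1 c1 * qdisc 1 b2 c2 * (R' ^+ 2 * c2' ^+ 2) = 2 ^+ 2 * P.
    have RE' : qres 4 b1 c1 1 b2 c2 = 2 * R' by rewrite -RE /qres; ring.
    have : c1 * c1 * (qdisc 4 b1 c1 * qdisc 1 b2 c2 * (R' ^+ 2 * c2' ^+ 2)) * 64 = 256 * P.
      by rewrite -N RE' c2E; ring.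
    by rewrite c1c1 mul1r; move: (_ * _ * (_ * _)) => z; clear; lia.
  have D2o : ~~ evz (qdisc 1 b2 c2) by rewrite /qdisc !evzE (negPf b2o).
  have c2'_dvd : (`|c2'|%N %| 2 ^ 2)%N.
    apply: (@sqr_dvd_pow2 2 c2' (qdisc 4 b1 c1 * qdisc 1 b2 c2 * R' ^+ 2)).
    by rewrite -N; ring.
  case: (dvd_pow2_or N) => [/(odd_dvd_pow2 D1o)|/(odd_dvd_pow2 D2o)]; rewrite /qdisc.
    case: c1E => -> [] h; have := @sqr_neq b1 (b1 ^+ 2) _ (erefl _); apply;
      by move: (b1 ^+ 2) h => z h; rewrite !inE; clear -h; lia.
  (* As [c2'] divides 4, the term [4 * c2] is 16, 32 or 64 up to sign. *)
  have : `|c2'|%N \in divisors (2 ^ 2) by rewrite -dvdn_divisors.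
  rewrite !inE c2E => c2'V D2E; have := @sqr_neq b2 (b2 ^+ 2) _ (erefl _); apply.
  by move: (b2 ^+ 2) D2E => z D2E; rewrite !inE; clear -c2'V D2E; lia.
have [t1 c1E] : exists t1, c1 = 4 * t1.
  by apply: (@odd_cancel4 c2 _ t) => //; rewrite mulrC.
have : evz b2 by have := congr1 evz g2; rewrite c1E !evzE (negPf b1o) /=; case: (evz b2).
move=> /evzP[b2' b2E].
have : ~~ evz b2'.
  have : 2 * c2 + b1 * b2' + 2 * t1 = 2 * v + a * b by clear -g2 c1E b2E; lia.
  by move=> /(congr1 evz); rewrite !evzE (negPf b1o) (negPf ao) (negPf bo) /=; case: (evz b2').
move=> /oddzP[j b2'E].
(* With [b2 = 2 * (2 * j + 1)], the second discriminant is [16 * j * (j + 1)] for [c2 = 1], one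
   factor 2 too many; for [c2 = -1] it is 8 times an odd number, and the exponent of 2 in the
   product is odd, not 8. *)
have c2E : c2 = 1 \/ c2 = -1.
  apply: (@odd_sqr_dvd 8 c2
    (qdisc 4 b1 c1 * qdisc 1 b2 c2 * qres 4 b1 c1 1 b2 c2 ^+ 2 * c1 ^+ 2) c2e).
  by rewrite [RHS](_ : _ = 256 * P) // -N; ring.
have Ro : ~~ evz (qres 4 b1 c1 1 b2 c2).
  by rewrite /qres c1E b2E !evzE (negPf b1o) (negPf c2e).
case: c2E => c2E.
  have : j * (j + 1) * qdisc 4 b1 c1 * qres 4 b1 c1 1 b2 c2 ^+ 2 * t1 ^+ 2 = P.
    have : 256 * (j * (j + 1) * qdisc 4 b1 c1 * qres 4 b1 c1 1 b2 c2 ^+ 2 * t1 ^+ 2) = 256 * P.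
      by rewrite -N [in qdisc 1 _ _]/qdisc c2E c1E b2E b2'E; ring.
    by move: (_ * _ ^+ 2) => z; clear; lia.
  by move=> /(congr1 evz); rewrite !evzE (negPf P_odd) /=; case: (evz j).
have {}N : (2 * (j * (j + 1)) + 1) * qdisc 4 b1 c1 * qres 4 b1 c1 1 b2 c2 ^+ 2 * t1 ^+ 2 = 2 * P.
  have : 128 * ((2 * (j * (j + 1)) + 1) * qdisc 4 b1 c1 *
      qres 4 b1 c1 1 b2 c2 ^+ 2 * t1 ^+ 2) = 256 * P.
    by rewrite -N [in qdisc 1 _ _]/qdisc c2E c1E b2E b2'E; ring.
  by move: (_ * _ ^+ 2) => z; clear; lia.
case: (boolP (evz t1)) => [/evzP[s t1E] | t1o].
  have : 2 * ((2 * (j * (j + 1)) + 1) * qdisc 4 b1 c1 * qres 4 b1 c1 1 b2 c2 ^+ 2 * s ^+ 2) = P.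
    apply: (@mulfI _ (2 : int)) => //; rewrite -N t1E; ring.
  by move=> /(congr1 evz); rewrite evzM (negPf P_odd).
by have := congr1 evz N; rewrite !expr2 !evzM evzD evzM (negPf D1o) (negPf Ro) (negPf t1o).
Qed.

(** The congruences force all of [b1], [b2], [c1], [c2] to be even; both quadratics are then
    divisible by 2, and [2 ^ 16] divides the product. *)
Lemma no_lead_2_2 (b1 c1 b2 c2 a b u v w t : int) :
    2 * b2 + 2 * b1 = 4 * u + a ^+ 2 ->
    2 * c2 + b1 * b2 + c1 * 2 = 4 * v + 2 * (a * b) ->
    c1 * c2 = 4 * t ->
    qdisc 2 b1 c1 * qdisc 2 b2 c2 * qres 2 b1 c1 2 b2 c2 ^+ 2 * (c1 * c2) ^+ 2 = 256 * P ->
  False.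
Proof.
move=> g3 g2 g0 N.
have : evz (a ^+ 2) by have := congr1 evz g3; rewrite !evzE /=.
rewrite expr2 evzM orbb => /evzP[a' aE].
have b12 : b1 + b2 = 2 * (u + a' * a') by clear -g3 aE; lia.
have [b1e b2e] : evz b1 /\ evz b2.
  apply/andP; have := congr1 evz b12; have := congr1 evz g2; rewrite !evzE orbT /=.
  by case: (evz b1) (evz b2) => [] [].
have [[b1' b1E] [b2' b2E]] := (evzP b1e, evzP b2e).
have c12 : c1 + c2 = 2 * (v + a' * b - b1' * b2') by clear -g2 aE b1E b2E; lia.
have [c1e c2e] : evz c1 /\ evz c2.
  apply/andP; have := congr1 evz c12; have := congr1 evz g0; rewrite !evzE /=.
  by case: (evz c1) (evz c2) => [] [].
have [[c1' c1E] [c2' c2E]] := (evzP c1e, evzP c2e).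
apply: (@neq_512M (128 * (b1' ^+ 2 - 4 * c1') * (b2' ^+ 2 - 4 * c2') *
   ((c2' - c1') ^+ 2 - (b2' - b1') * (b1' * c2' - b2' * c1')) ^+ 2 * (c1' * c2') ^+ 2)).
by rewrite -N /qdisc /qres b1E b2E c1E c2E; ring.
Qed.

(* The hypotheses say that [q1 q2 = x (a x + b) ^ 2] modulo 4 for the quadratics
   [q1], [q2] with coefficients [a1, b1, c1] and [a2, b2, c2]. *)
Lemma no_integral_root (a1 b1 c1 a2 b2 c2 a b u v w t : int) :
    a1 * a2 = 4 ->
    a1 * b2 + b1 * a2 = 4 * u + a ^+ 2 ->
    a1 * c2 + b1 * b2 + c1 * a2 = 4 * v + 2 * (a * b) ->
    b1 * c2 + c1 * b2 = 4 * w + b ^+ 2 ->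
    c1 * c2 = 4 * t ->
    qdisc a1 b1 c1 * qdisc a2 b2 c2 * qres a1 b1 c1 a2 b2 c2 ^+ 2 * (c1 * c2) ^+ 2 = 256 * P ->
  False.
Proof.
wlog a1_gt0 : a1 b1 c1 a2 b2 c2 / 0 < a1.
  move=> IH g4 g3 g2 g1 g0 N; case: (ltrP 0 a1) => [a1_gt0 | a1_le0].
    exact: (IH a1 b1 c1 a2 b2 c2).
  have a1_lt0 : 0 < - a1.
    by rewrite oppr_gt0 lt_neqAle a1_le0 andbT; apply/eqP => h; rewrite h mul0r in g4.
  apply: (IH (- a1) (- b1) (- c1) (- a2) (- b2) (- c2)) => //; rewrite ?mulrNN //.
  by rewrite -N /qdisc /qres; ring.
move=> g4 g3 g2 g1 g0 N.
have a1_le4 : a1 <= 4.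
  have := congr1 absz g4; rewrite abszM (_ : absz 4 = 4%N) // => a12.
  have : (`|a1|%N %| 4)%N by rewrite -a12 dvdn_mulr.
  by move=> /dvdn_leq; clear -a1_gt0; lia.
have [[a1E a2E] | [[a1E a2E] | [a1E a2E]]] :
   (a1 = 4 /\ a2 = 1) \/ (a1 = 2 /\ a2 = 2) \/ (a1 = 1 /\ a2 = 4).
  have : a1 = 1 \/ a1 = 2 \/ a1 = 3 \/ a1 = 4 by clear -a1_gt0 a1_le4; lia.
  by move=> [|[|[|]]] a1E; rewrite a1E in g4 *; clear -g4; lia.
- move: g3 g2 N; rewrite a1E a2E => g3 g2 N.
  apply: (@no_lead_4_1 b1 c1 b2 c2 a b u v w t) => //; first by rewrite -g3; ring.
  by rewrite -g1; ring.
- move: g3 g2 N; rewrite a1E a2E => g3 g2 N.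
  by apply: (@no_lead_2_2 b1 c1 b2 c2 a b u v w t) => //; rewrite -g3; ring.
- move: g3 g2 N; rewrite a1E a2E => g3 g2 N.
  apply: (@no_lead_4_1 b2 c2 b1 c1 a b u v w t) => //.
  + by rewrite -g3; ring.
  + by rewrite -g2; ring.
  + by rewrite -g1; ring.
  + by rewrite -g0; ring.
  + by rewrite -N /qres; ring.
Qed.

(** The equation says that 4 times the discriminant is [(m + 2 * b) ^ 2 - 1], so the discriminant is
    a product of consecutive integers. If both are powers of 2 up to sign, their product is 2, but
    evenness of [b] makes it divisible by 4. *)
Lemma qdisc_ndvd_pow2 (b c m : int) : ~~ evz m ->
    m ^+ 2 + b * 4 * m + c * 4 ^+ 2 = 1 -> ~~ (`|(qdisc 1 b c : int)|%N %| 2 ^ 8)%N.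
Proof.
move=> /oddzP[j mE] l1; apply/negP.
have dE : qdisc 1 b c = (j + b) * (j + b + 1).
  by apply: (@mulfI _ (4 : int)) => //; move: l1; rewrite /qdisc mE; clear; lia.
have : evz (b ^+ 2).
  have := congr1 evz dE; rewrite /qdisc !evzE /=; by case: (evz j) (evz b) => [] [].
rewrite expr2 evzM orbb => /evzP[b' bE].
have d4 : qdisc 1 b c = 4 * (b' * b' - c) by rewrite /qdisc bE; ring.
rewrite dE in d4 *; move: (j + b) d4 => k d4.
rewrite abszM => dvd8.
have dvd1 := dvdn_trans (dvdn_mulr _ (dvdnn _)) dvd8.
have dvd2 := dvdn_trans (dvdn_mull _ (dvdnn _)) dvd8.
case: (boolP (evz k)) => ke.
  have : ~~ evz (k + 1) by rewrite evzD ke.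
  move=> /odd_dvd_pow2 /(_ dvd2) kE; move: d4 dvd1; case: kE => kE; rewrite kE.
    by have -> : k = 0 by clear -kE; lia.
  have -> : k = - 2 by clear -kE; lia.
  by move: (b' * b' - c) => z; clear; lia.
have := odd_dvd_pow2 ke dvd1 => -[] kE; move: d4 dvd2; rewrite kE.
  by move: (b' * b' - c) => z; clear; lia.
by [].
Qed.

Lemma no_quarter_root (a1 b1 c1 a2 b2 c2 m : int) :
    a1 * a2 = 1 -> ~~ evz m -> quintic_disc 4 m a1 b1 c1 a2 b2 c2 = 256 * P -> False.
Proof.
rewrite /quintic_disc => a12 mo N.
have main (a b c M : int) : a = 1 \/ a = - 1 -> (lres 4 m a b c) ^+ 2 * M = 2 ^+ 8 * P ->
    ~~ (`|(qdisc a b c : int)|%N %| 2 ^ 8)%N.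
  move=> aE lM; have lo : ~~ evz (lres 4 m a b c).
    have ao : ~~ evz a by case: aE => ->.
    by rewrite /lres !evzE (negPf mo) (negPf ao) !orbT.
  have lE := odd_sqr_dvd lo lM.
  have aa : a * a = 1 by case: aE => ->.
  have -> : qdisc a b c = qdisc 1 (a * b) (a * c).
    by rewrite /qdisc exprMn (expr2 a) aa; ring.
  apply: (qdisc_ndvd_pow2 mo).
  have [i mE] := oddzP mo.
  have <- : a * lres 4 m a b c = m ^+ 2 + a * b * 4 * m + a * c * 4 ^+ 2.
    by rewrite -[m ^+ 2]mul1r -aa /lres; ring.
  (* The product is 1 modulo 4, which selects 1 among the values 1 and -1. *)
  have : a * lres 4 m a b c = 4 * (a * a * (i * i + i) + a * b * m + a * c * 4) + a * a.
    by rewrite /lres mE; ring.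
  rewrite aa; move: (_ + _ * 4) => z.
  by case: aE lE => -> [] ->; clear; lia.
have [a1E a2E] : (a1 = 1 \/ a1 = -1) /\ (a2 = 1 \/ a2 = -1).
  have := congr1 absz a12; rewrite abszM => /eqP; rewrite muln_eq1 => /andP[]; clear; lia.
have n1 := main _ _ _
  (qdisc a1 b1 c1 * qdisc a2 b2 c2 * qres a1 b1 c1 a2 b2 c2 ^+ 2 * lres 4 m a2 b2 c2 ^+ 2) a1E.
have n2 := main _ _ _
  (qdisc a1 b1 c1 * qdisc a2 b2 c2 * qres a1 b1 c1 a2 b2 c2 ^+ 2 * lres 4 m a1 b1 c1 ^+ 2) a2E.
have := @dvd_pow2_or 8 (qdisc a1 b1 c1) (qdisc a2 b2 c2)
  (qres a1 b1 c1 a2 b2 c2 ^+ 2 * (lres 4 m a1 b1 c1 * lres 4 m a2 b2 c2) ^+ 2).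
rewrite [2 ^+ 8](_ : _ = 256) // -N in n1 n2 * => /(_ (mulrA _ _ _)).
by case; apply/negP; [apply: n1 | apply: n2]; ring.
Qed.

(** Here [g3] and [g2] are the coefficients of degrees 3 and 2 of [q1 q2], whose leading coefficient
    is 2. The first equation makes [g3] odd, hence [be * g3] odd, while the second makes it even. *)
Lemma no_half_root (be g3 g2 a b u v : int) : ~~ evz be ->
    2 * g3 - be * 2 = 4 * u + a ^+ 2 -> 2 * g2 - be * g3 = 4 * v + 2 * (a * b) -> False.
Proof.
move=> beo h4 h3; have : evz (a ^+ 2) by have := congr1 evz h4; rewrite !evzE orbT.
rewrite expr2 evzM orbb => /evzP[a' aE].
have h : g3 - be = 2 * (u + a' * a') by clear -h4 aE; lia.
have := congr1 evz h; have := congr1 evz h3.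
by rewrite !evzE (negPf beo) /=; case: (evz g3).
Qed.

End PrimeTimesPow2.

(** * Integral factorizations of 4 P + Q ^ 2 *)

Lemma coef_quad (R : nzRingType) (a b c : R) i :
  (quad a b c)`_i = [:: c; b; a]`_i.
Proof.
rewrite /quad !coefD !coefZ coefXn coefX coefC.
by case: i => [|[|[|i]]] /=; rewrite ?nth_nil !(mulr1, mulr0, add0r, addr0).
Qed.

Lemma quad_coef (R : nzRingType) (q : {poly R}) : (size q <= 3)%N -> q = quad q`_2 q`_1 q`_0.
Proof.
move=> q3; apply/polyP => -[|[|[|i]]]; rewrite coef_quad //=.
by rewrite nth_nil nth_default // (leq_trans q3).
Qed.

Lemma coef_quadM (R : nzRingType) (a b c a' b' c' : R) i : (i < 6)%N ->
  (quad a b c * quad a' b' c')`_i =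
  [:: c * c'; c * b' + b * c'; c * a' + b * b' + a * c'; b * a' + a * b'; a * a']`_i.
Proof.
rewrite coefM; case: i => [|[|[|[|[|[|i]]]]]] // _;
by rewrite !big_ord_recr big_ord0 /= !coef_quad /= !(mulr0, mul0r, add0r, addr0).
Qed.

Lemma coef_XsubCM (R : comNzRingType) (al be : R) (q : {poly R}) i :
  ((al *: 'X - be%:P) * q)`_i.+1 = al * q`_i - be * q`_i.+1.
Proof. by rewrite mulrBl coefB -scalerAl coefZ coefXM coefCM. Qed.

Lemma quad_shift (R : comNzRingType) (a b c be : R) :
  quad a b c \Po ('X + be%:P) = quad a (b + 2 * a * be) (a * be ^+ 2 + b * be + c).
Proof.
rewrite /quad !comp_polyD !comp_polyZ comp_Xn_poly comp_polyX comp_polyC.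
have two : (2 : R)%:P = 2 by rewrite rmorph_nat.
by rewrite -!mul_polyC !(two, polyCD, polyCM, polyC_exp); ring.
Qed.

Section CompletedSquare.

Variable p : int.
Hypotheses (p_prime : prime `|p|%N) (p_odd : ~~ evz p).
Variables (P Q : {poly int}).
Hypotheses (P_monic : P \is monic) (szP : size P = 6%N) (szQ : (size Q <= 3)%N).

Let P5 : P`_5 = 1.
Proof. by have := monicP P_monic; rewrite /lead_coef szP. Qed.

Let F := 4 *: P + Q ^+ 2.

Lemma coef_completed_square i : (i < 6)%N -> F`_i = 4 * P`_i +
   [:: Q`_0 * Q`_0; Q`_0 * Q`_1 + Q`_1 * Q`_0; Q`_0 * Q`_2 + Q`_1 * Q`_1 + Q`_2 * Q`_0;
     Q`_1 * Q`_2 + Q`_2 * Q`_1; Q`_2 * Q`_2]`_i.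
Proof. by move=> i6; rewrite coefD coefZ expr2 (quad_coef szQ) coef_quadM ?coef_quad. Qed.

Lemma no_zero_root a1 b1 c1 a2 b2 c2 :
    F = (1 *: 'X - 0%:P) * (quad a1 b1 c1 * quad a2 b2 c2) ->
    qdisc a1 b1 c1 * qdisc a2 b2 c2 * qres a1 b1 c1 a2 b2 c2 ^+ 2 * (c1 * c2) ^+ 2 = 256 * p ->
  False.
Proof.
move=> FE N.
have coefE i : (i < 5)%N -> F`_i.+1 = (quad a1 b1 c1 * quad a2 b2 c2)`_i.
  by move=> _; rewrite FE coef_XsubCM mul1r mul0r subr0.
have F0 : F`_0 = 0 by rewrite FE scale1r subr0 coefXM.
have [Q0 Q0E] : exists Q0, Q`_0 = 2 * Q0.
  apply: evzP; rewrite coef_completed_square //= in F0.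
  by have := congr1 evz F0; rewrite !evzE; case: (evz Q`_0).
have := coefE 4%N isT; have := coefE 3%N isT; have := coefE 2%N isT.
have := coefE 1%N isT; have := coefE 0%N isT.
rewrite !coef_quadM //= !coef_completed_square //= P5 Q0E => g0 g1 g2 g3 g4.
(* The constant term of [Q] is even, so [Q ^ 2] is [x ^ 2 (a x + b) ^ 2] modulo 4, with [a] and [b]
   the higher coefficients of [Q]; the cross terms with [Q0] are multiples of 4 and go into [w] and
   [t]. *)
apply: (no_integral_root p_prime p_odd (u := P`_4) (v := P`_3) (w := P`_2 + Q0 * Q`_2)
  (t := P`_1 + Q0 * Q`_1) (a := Q`_2) (b := Q`_1) _ _ _ _ _ N).
- by rewrite -g4.
- by rewrite addrC -g3; ring.
- by transitivity (c1 * a2 + b1 * b2 + a1 * c2); [ring | rewrite -g2; ring].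
- by rewrite addrC -g1; ring.
- by rewrite -g0; ring.
Qed.

Lemma mul_lead_coefs al be a1 b1 c1 a2 b2 c2 :
    F = (al *: 'X - be%:P) * (quad a1 b1 c1 * quad a2 b2 c2) ->
  al * (a1 * a2) = 4.
Proof.
move/(congr1 (coefp 5)); rewrite /= coef_XsubCM !coef_quadM //= mulr0 subr0.
by rewrite coef_completed_square // P5 => <-; rewrite addr0.
Qed.

End CompletedSquare.

Section Factorization.

Variable p : int.
Hypotheses (p_prime : prime `|p|%N) (p_odd : ~~ evz p).

(** Since [al] divides 4, the root is [be / al] with [al] equal to 1, 2 or 4 after a sign change; an
    even [be] reduces [al] to a smaller case. *)
Lemma no_factorization (P Q : {poly int}) (al be a1 b1 c1 a2 b2 c2 : int) :
    P \is monic -> size P = 6%N -> (size Q <= 3)%N ->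
    4 *: P + Q ^+ 2 = (al *: 'X - be%:P) * (quad a1 b1 c1 * quad a2 b2 c2) ->
    quintic_disc al be a1 b1 c1 a2 b2 c2 = 256 * p ->
  False.
Proof.
move=> P_monic szP szQ.
(* An integral root is translated to 0. This preserves the discriminants and the resultant, and the
   values of the quadratics at the root become their constant terms. *)
have case1 be' a1' b1' c1' :
    4 *: P + Q ^+ 2 = (1 *: 'X - be'%:P) * (quad a1' b1' c1' * quad a2 b2 c2) ->
    quintic_disc 1 be' a1' b1' c1' a2 b2 c2 = 256 * p -> False.
  move=> FE N.
  have sz1 : size ('X + be'%:P : {poly int}) = 2%N by rewrite -[be']opprK polyCN size_XsubC.
  have szc (q : {poly int}) : size (q \Po ('X + be'%:P)) = size q by rewrite size_comp_poly2.
  have cE := quad_shift a1' b1' c1' be'; have c'E := quad_shift a2 b2 c2 be'.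
  have FE' : 4 *: (P \Po ('X + be'%:P)) + (Q \Po ('X + be'%:P)) ^+ 2 =
     (1 *: 'X - 0%:P) * (quad a1' (b1' + 2 * a1' * be') (a1' * be' ^+ 2 + b1' * be' + c1')
       * quad a2 (b2 + 2 * a2 * be') (a2 * be' ^+ 2 + b2 * be' + c2)).
    rewrite -cE -c'E -!rmorphM -rmorphXn -comp_polyZ -rmorphD /= FE !rmorphM /=.
    by rewrite !scale1r rmorphB /= comp_polyX comp_polyC addrK subr0.
  apply: (no_zero_root p_prime p_odd _ _ _ FE'); rewrite ?szc //.
    by rewrite monicE lead_coef_comp ?sz1 // -[be']opprK polyCN lead_coefXsubC expr1n mulr1 -monicE.
  rewrite -N /quintic_disc /lres !expr1n !mulr1.
  have dE a b c : qdisc a (b + 2 * a * be') (a * be' ^+ 2 + b * be' + c) = qdisc a b c.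
    by rewrite /qdisc; ring.
  rewrite !dE; congr (_ * _ ^+ 2 * _); rewrite /qres; ring.
(* A common factor 2 of the linear form is moved into the first quadratic; the product and its
   discriminant do not change. *)
have half al' be' a1' b1' c1' :
    4 *: P + Q ^+ 2 = ((2 * al') *: 'X - (2 * be')%:P) * (quad a1' b1' c1' * quad a2 b2 c2) ->
    quintic_disc (2 * al') (2 * be') a1' b1' c1' a2 b2 c2 = 256 * p ->
    4 *: P + Q ^+ 2 = (al' *: 'X - be'%:P) *
      (quad (2 * a1') (2 * b1') (2 * c1') * quad a2 b2 c2) /\
    quintic_disc al' be' (2 * a1') (2 * b1') (2 * c1') a2 b2 c2 = 256 * p.
  move=> -> <-; split; last by rewrite /quintic_disc /qdisc /qres /lres; ring.
  by rewrite /quad -!mul_polyC !polyCM; ring.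
have case2 be' a1' b1' c1' :
    4 *: P + Q ^+ 2 = (2 *: 'X - be'%:P) * (quad a1' b1' c1' * quad a2 b2 c2) ->
    quintic_disc 2 be' a1' b1' c1' a2 b2 c2 = 256 * p -> False.
  case: (boolP (evz be')) => [/evzP[be'' ->] | be'o].
    by rewrite -{1 2}[2]mulr1 => FE N; have [] := half 1 be'' a1' b1' c1' FE N; exact: case1.
  move=> FE _; have c4 := congr1 (coefp 4) FE; have c3 := congr1 (coefp 3) FE.
  move: c3 c4 (mul_lead_coefs P_monic szP szQ FE); rewrite /= !coef_XsubCM.
  rewrite !coef_completed_square //= !coef_quadM //=.
  move=> c3 c4 c5; apply: (no_half_root be'o (g3 := b1' * a2 + a1' * b2)
     (g2 := c1' * a2 + b1' * b2 + a1' * c2) (u := P`_4) (v := P`_3) (a := Q`_2) (b := Q`_1)).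
    have a12 : a1' * a2 = 2 by clear -c5; lia.
    by rewrite a12 in c4; rewrite -c4; ring.
  by rewrite -c3; ring.
wlog al_gt0 : al be a1 b1 c1 / 0 < al.
  move=> IH FE N; have alE := mul_lead_coefs P_monic szP szQ FE.
  case: (ltrP 0 al) => [al_gt0 | al_le0]; first exact: (IH al be a1 b1 c1).
  apply: (IH (- al) (- be) (- a1) (- b1) (- c1)).
  - by rewrite oppr_gt0 lt_neqAle al_le0 andbT; apply/eqP => h; rewrite h mul0r in alE.
  - by rewrite FE /quad -!mul_polyC !polyCN; ring.
  - by rewrite -N /quintic_disc /qdisc /qres /lres; ring.
move=> FE N; have alE := mul_lead_coefs P_monic szP szQ FE.
have : al = 1 \/ al = 2 \/ al = 4.
  have := congr1 absz alE; rewrite abszM (_ : absz 4 = 4%N) // => al4.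
  have : `|al|%N \in divisors 4 by rewrite -dvdn_divisors // -al4 dvdn_mulr.
  by rewrite !inE; clear -al_gt0; lia.
move=> [|[|]] alE'; rewrite alE' in FE N.
- exact: case1 FE N.
- exact: case2 FE N.
case: (boolP (evz be)) => [/evzP[be' beE] | beo].
  rewrite beE (_ : 4 = 2 * 2) // in FE N.
  by have [] := half 2 be' a1 b1 c1 FE N; exact: case2.
apply: (no_quarter_root p_prime p_odd _ beo N).
by move: alE; rewrite alE'; lia.
Qed.

End Factorization.

(** * Weierstrass points and roots *)

Local Notation pQtoC := (map_poly (ratr : rat -> algC)).

Lemma homC_affine (f : {poly rat}) n (X Z : algC) : (size f <= n.+1)%N -> Z != 0 ->
  homC f n X Z = Z ^+ n * (pQtoC f).[X / Z].
Proof.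
move=> szf Z0; rewrite (horner_coef_wide _ (n := n.+1)) ?size_map_poly //.
rewrite mulr_sumr; apply: eq_bigr => i _.
have Zi : Z ^+ i != 0 by rewrite expf_neq0.
have -> : Z ^+ n = Z ^+ (n - i) * Z ^+ i by rewrite -exprD subnK ?leq_ord.
by rewrite coef_map /= expr_div_n; field.
Qed.

Lemma homC_infty (f : {poly rat}) n (X : algC) : (size f <= n)%N -> homC f n X 0 = 0.
Proof.
move=> szf; apply: big1 => i _; rewrite expr0n subn_eq0.
case: leqP => [le_ni | _]; last by rewrite mulr0.
by rewrite nth_default ?rmorph0 ?mul0r // (leq_trans szf).
Qed.

(** The quadratic is the norm [(u2 x - u1) ^ 2 - d (v2 x - v1) ^ 2] of
    [(u2 + v2 s) x - (u1 + v1 s)]. *)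
Lemma root_quadratic_elt (R S : comNzRingType) (f : {rmorphism R -> S})
    (u1 v1 u2 v2 d : R) (s x : S) :
    s ^+ 2 = f d -> x * (f u2 + f v2 * s) = f u1 + f v1 * s ->
  root (map_poly f (quad (u2 ^+ 2 - d * v2 ^+ 2) (2 * (d * v1 * v2 - u1 * u2))
                         (u1 ^+ 2 - d * v1 ^+ 2))) x.
Proof.
move=> sE xE.
have mapE a b c : (map_poly f (quad a b c)).[x] = f a * x ^+ 2 + f b * x + f c.
  by rewrite /quad !rmorphD /= !map_polyZ map_polyC map_polyXn map_polyX !hornerE.
rewrite /root mapE !(rmorph_nat, rmorphB, rmorphXn, rmorphM) /= -sE.
rewrite [eqbLHS](_ : _ = (f u1 - x * f u2) ^+ 2 - (s * (x * f v2 - f v1)) ^+ 2); last by ring.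
suff -> : f u1 - x * f u2 = s * (x * f v2 - f v1) by rewrite subrr.
apply/eqP; rewrite -subr_eq0.
rewrite [eqbLHS](_ : _ = f u1 + f v1 * s - x * (f u2 + f v2 * s)); last by ring.
by rewrite xE subrr.
Qed.

Section Weierstrass.

Variables P Q : {poly rat}.
Hypotheses (szP : (size P <= 6)%N) (szQ : (size Q <= 3)%N).
Let F := 4 *: P + Q ^+ 2.

(** The involution fixes [X] and [Z], so the scaling factor is 1 once one of them is nonzero, and
    [2 Y + Q = 0]; completing the square gives [F(X / Z) = 0]. At infinity the degree bounds force
    [Y = 0]. *)
Lemma weierstrass_ptE X Y Z : weierstrass_pt P Q (X, Y, Z) ->
  (Z = 0 /\ X != 0 /\ Y = 0) \/
  [/\ Z != 0, root (pQtoC F) (X / Z) & Y = - (homC Q 3 X Z) / 2].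
Proof.
move=> [[nz on_C] [l l0 [XE YE ZE]]].
have YE' : X != 0 \/ Z != 0 -> Y = - (homC Q 3 X Z) / 2.
  move=> XZ; have l1 : l = 1.
    case: XZ => /mulIf; apply; rewrite mul1r -?XE -?ZE //.
  rewrite l1 expr1n mul1r in YE; apply: (canRL (mulfK _)); first by rewrite pnatr_eq0.
  by rewrite mulr_natr mulr2n {2}YE; ring.
have [Z0 | Z0] := eqVneq Z 0.
  left; rewrite Z0 homC_infty // mul0r addr0 homC_infty // in on_C.
  have Y0 : Y = 0 by apply/eqP; rewrite -sqrf_eq0 on_C.
  split=> //; split=> //; apply: contra nz => /eqP ->.
  by rewrite Y0 Z0.
right; have {}YE := YE' (or_intror Z0); split=> //.
have szP' : (size P <= 7)%N by rewrite (leq_trans szP).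
have szQ' : (size Q <= 4)%N by rewrite (leq_trans szQ).
have Z6 : Z ^+ 6 * 4 != 0 by rewrite mulf_neq0 ?expf_neq0 ?pnatr_eq0.
rewrite /root rmorphD /= map_polyZ rmorphXn /= ratr_nat hornerD hornerZ horner_exp.
move: on_C; rewrite YE !homC_affine //; move: (_.[_]) (_.[_]) => q r on_C.
apply/eqP/(mulfI Z6); rewrite mulr0.
rewrite (_ : Z ^+ 6 * 4 * (4 * q + r ^+ 2) = 16 * (Z ^+ 6 * q) + 4 * Z ^+ 6 * r ^+ 2); last by ring.
by rewrite -on_C; field.
Qed.

Lemma rational_infty X : X != 0 -> rational_pt (X, 0, 0).
Proof.
move=> X0; exists (1, 0, 0); split; last by split; rewrite /inQ ?rpred0 ?rpred1.
by exists X^-1; rewrite ?invr_eq0 // mulVf // !mulr0.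
Qed.

(** The coordinate [Y] is determined by [X] and [Z] through [- Q / 2], so only [X / Z] matters. *)
Lemma rational_affine X Y Z : weierstrass_pt P Q (X, Y, Z) -> Z != 0 ->
  rational_pt (X, Y, Z) <-> X / Z \in Crat.
Proof.
move=> W Z0; have [[ZE _] | [_ _ YE]] := weierstrass_ptE W; first by rewrite ZE eqxx in Z0.
split=> [[[[X' Y'] Z'] [[l l0 [-> _ ->]] [XQ _ ZQ]]] | xQ].
  by rewrite -(mulfK l0 X) -[Z](mulfK l0) -mulf_div divff ?invr_eq0 // mulr1
     ![_ * l]mulrC rpred_div.
exists (X / Z, - (pQtoC Q).[X / Z] / 2, 1); split; last first.
  split; rewrite /inQ ?rpred1 //; case/CratP: xQ => x ->.
  by rewrite horner_map /= rpred_div ?rpredN ?Crat_rat ?rpred_nat.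
exists Z^-1; first by rewrite invr_eq0.
have szQ' : (size Q <= 4)%N by rewrite (leq_trans szQ).
rewrite YE homC_affine // mulVf //; split=> //; first by rewrite mulrC.
by field.
Qed.

(** Only one Weierstrass point lies at infinity, so one of two inequivalent ones is affine. *)
Lemma rational_root : exactly_two_rational_WP P Q -> exists r : rat, root F r.
Proof.
move=> [[[X1 Y1] Z1] [[[X2 Y2] Z2] [[W1 R1] [W2 R2] neq _]]].
have affine X Y Z : weierstrass_pt P Q (X, Y, Z) -> rational_pt (X, Y, Z) -> Z != 0 ->
    exists r : rat, root F r.
  move=> W R Z0; have /CratP[r rE] : X / Z \in Crat by apply: (proj1 (rational_affine W Z0)).
  exists r; have [[ZE] | [_]] := weierstrass_ptE W; first by rewrite ZE eqxx in Z0.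
  by rewrite rE fmorph_root.
have [[Z1E [X10 Y1E]] | [Z10 _ _]] := weierstrass_ptE W1; last exact: affine W1 R1 Z10.
have [[Z2E [X20 Y2E]] | [Z20 _ _]] := weierstrass_ptE W2; last exact: affine W2 R2 Z20.
case: neq; rewrite Z1E Y1E Z2E Y2E; exists (X2 / X1); first by rewrite mulf_neq0 ?invr_eq0.
by rewrite !mulr0 divfK.
Qed.

(** The factor is the minimal polynomial of [X / Z] over the rationals, for the given quadratic
    Weierstrass point. *)
Lemma quadratic_factor : has_quadratic_WP P Q ->
  exists A : {poly rat}, [/\ size A = 3%N, A %| F & forall r, ~~ root A r].
Proof.
move=> [[[X Y] Z] [W [[s [/CratP[d sE] [[[X' Y'] Z'] [[l l0 [X'E _ Z'E]] [X'Q _ Z'Q]]]]] nR]]].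
have [[ZE [X0 YE]] | [Z0 Froot _]] := weierstrass_ptE W.
  by case: nR; rewrite ZE YE; exact: rational_infty.
have nQ : X / Z \notin Crat by apply/negP => /(proj2 (rational_affine W Z0))/nR.
set x := X / Z in Froot nQ *.
have [A [_ A_monic AP]] := minCpolyP x.
have Aroot : root (pQtoC A) x by rewrite AP.
(* Splitting off a linear factor would either leave a smaller polynomial vanishing at [x] or make
   [x] rational. *)
have Ar r : ~~ root A r.
  apply/negP => /factor_theorem[B AE].
  have B0 : B != 0 by apply: contraNneq (monic_neq0 A_monic) => B0; rewrite AE B0 mul0r.
  move: Aroot; rewrite AE rmorphM rootM AP => /orP[/(dvdp_leq B0)|].
    by rewrite AE size_Mmonic ?monicXsubC // size_XsubC addnC ltnn.
  rewrite rmorphB /= map_polyX map_polyC root_XsubC => /eqP xr.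
  by move: nQ; rewrite xr Crat_rat.
exists A; split=> //; last by rewrite -AP.
have Z'0 : Z' != 0 by rewrite Z'E mulf_neq0.
have xE : x = X' / Z' by rewrite X'E Z'E -mulf_div divff // mul1r.
have [[u1 [v1 X'uv]] [u2 [v2 Z'uv]]] := (X'Q, Z'Q).
have sQ : s \notin Crat.
  apply: contra nQ => sQ; rewrite xE X'uv Z'uv.
  have uvQ u v : ratr u + ratr v * s \in Crat.
    by apply: rpredD; [exact: Crat_rat | apply: rpredM => //; exact: Crat_rat].
  by rewrite rpred_div ?uvQ.
(* A vanishing norm would make [d] a rational square, and [s] rational. *)
have lead0 : u2 ^+ 2 - d * v2 ^+ 2 != 0.
  apply/eqP => lead0; have v20 : v2 != 0.
    apply/eqP => v20; rewrite v20 expr0n mulr0 subr0 in lead0.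
    move/eqP: lead0; rewrite sqrf_eq0 => /eqP u20.
    by rewrite Z'uv u20 v20 rmorph0 mul0r addr0 eqxx in Z'0.
  have dE : d = (u2 / v2) ^+ 2 by rewrite expr_div_n; apply: (canRL (mulfK _));
    rewrite ?expf_neq0 //; apply/eqP; rewrite eq_sym -subr_eq0 lead0.
  move/eqP: sE; rewrite dE rmorphXn eqf_sqr /= => /orP[] /eqP sE;
    by move: sQ; rewrite sE ?rpredN Crat_rat.
pose T := quad (u2 ^+ 2 - d * v2 ^+ 2) (2 * (d * v1 * v2 - u1 * u2)) (u1 ^+ 2 - d * v1 ^+ 2).
have T0 : T != 0.
  have T2 : T`_2 = u2 ^+ 2 - d * v2 ^+ 2 by rewrite coef_quad.
  by apply: contra_neq lead0 => T0; rewrite -T2 T0 coef0.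
have szT : (size T <= 3)%N.
  by apply/leq_sizeP => -[|[|[|j]]] // _; rewrite coef_quad /= nth_nil.
have szA : (size A <= 3)%N.
  apply: leq_trans szT; apply: dvdp_leq => //; rewrite -AP.
  by apply: (root_quadratic_elt sE); rewrite -X'uv -Z'uv xE divfK.
case szE: (size A) szA => [|[|[|[|n]]]] // _.
- by move/eqP: szE; rewrite size_poly_eq0 (negPf (monic_neq0 A_monic)).
- have /eqP/size_poly1P[c c0 AE] := szE.
  by rewrite AE map_polyC rootC fmorph_eq0 (negPf c0) in Aroot.
have := Ar (- A`_0); rewrite /root horner_coef szE !big_ord_recr big_ord0 /= .
have -> : A`_1 = 1 by have := monicP A_monic; rewrite /lead_coef szE.
by rewrite add0r mul1r mulr1 expr1 addrN eqxx.
Qed.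

End Weierstrass.

(** * Gauss's lemma and the conclusion *)

Lemma size_polyQ (f : {poly int}) : size (polyQ f) = size f.
Proof. by rewrite /polyQ size_map_inj_poly ?rmorph0 //; exact: intr_inj. Qed.

Lemma linear_coef (R : nzRingType) (q : {poly R}) :
  (size q <= 2)%N -> q = q`_1 *: 'X - (- q`_0)%:P.
Proof.
move=> q2; apply/polyP => -[|[|i]]; rewrite coefB coefZ coefX coefC /=.
- by rewrite mulr0 sub0r opprK.
- by rewrite mulr1 subr0.
- by rewrite mulr0 subr0 nth_default // (leq_trans q2).
Qed.

(** Gauss's lemma is applied twice: to ['X - r%:P], then to [A], which divides the cofactor because
    it is coprime to the linear factor. *)
Lemma integral_factorization (F : {poly int}) (r : rat) (A : {poly rat}) :
    size F = 6%N -> root (polyQ F) r -> size A = 3%N -> A %| polyQ F -> ~~ root A r ->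
  exists al be a1 b1 c1 a2 b2 c2 : int,
    F = (al *: 'X - be%:P) * (quad a1 b1 c1 * quad a2 b2 c2).
Proof.
move=> szF rootF szA AF Ar.
have [p1 [a a0 rE] [G FE]] := dvdpP_rat_int (etrans (dvdp_XsubCl _ _) rootF).
have AG : A %| polyQ G.
  rewrite -(@Gauss_dvdpr _ _ (polyQ p1)); last first.
    by rewrite -(coprimepZr _ _ a0) -rE coprimep_XsubC.
  by rewrite /polyQ -rmorphM -FE.
have [q1 [a' a'0 AE] [q2 GE]] := dvdpP_rat_int AG.
have szp1 : size p1 = 2%N.
  by rewrite -(size_polyQ p1) -(size_scale _ a0) -rE size_XsubC.
have szq1 : size q1 = 3%N by rewrite -(size_polyQ q1) -(size_scale _ a'0) -AE.
have F0 : F != 0 by rewrite -size_poly_gt0 szF.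
have G0 : G != 0 by apply: contraNneq F0 => G0; rewrite FE G0 mulr0.
have q20 : q2 != 0 by apply: contraNneq G0 => q20; rewrite GE q20 mulr0.
have szq2 : size q2 = 3%N.
  have p10 : p1 != 0 by rewrite -size_poly_gt0 szp1.
  have q10 : q1 != 0 by rewrite -size_poly_gt0 szq1.
  have := szF; rewrite FE size_mul // GE size_mul // szp1 szq1 => sz6.
  by have [->] : (size q2).+3 = 6%N := sz6.
exists p1`_1, (- p1`_0), q1`_2, q1`_1, q1`_0, q2`_2, q2`_1, q2`_0.
by rewrite -linear_coef ?szp1 // -!quad_coef ?szq1 ?szq2 // -GE.
Qed.

Lemma size_quintic_model (P Q : {poly int}) :
  size P = 6%N -> (size Q <= 3)%N -> size (4 *: P + Q ^+ 2) = 6%N.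
Proof.
move=> szP szQ; have sz4P : size (4 *: P) = 6%N by rewrite size_scale.
rewrite size_polyDl sz4P // expr2 (leq_ltn_trans (size_polyMleq _ _)) //.
by move: szQ; lia.
Qed.

Lemma discE_factorization (P Q : {poly rat}) (F : {poly int})
    (al be a1 b1 c1 a2 b2 c2 : int) :
    polyQ F = 4 *: P + Q ^+ 2 ->
    F = (al *: 'X - be%:P) * (quad a1 b1 c1 * quad a2 b2 c2) ->
    al * (a1 * a2) = 4 -> discE P Q != 0 ->
  discE P Q = (quintic_disc al be a1 b1 c1 a2 b2 c2)%:~R / 256.
Proof.
move=> FQ FE lead4.
have nz (x y : int) : x * y = 4 -> x%:~R != 0 :> rat.
  by rewrite intr_eq0; case: eqP => // ->; rewrite mul0r.
have al0 := nz _ _ lead4.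
have a10 := nz a1 (al * a2) (etrans (mulrCA _ _ _) lead4).
have a20 : a2%:~R != 0 :> rat by apply: (nz _ (al * a1)); rewrite -lead4; ring.
have FQE : polyQ F = (al%:~R *: 'X - (be%:~R)%:P) *
    quad a1%:~R b1%:~R c1%:~R * quad a2%:~R b2%:~R c2%:~R.
  have quadQ (a b c : int) : polyQ (quad a b c) = quad a%:~R b%:~R c%:~R.
    by rewrite /polyQ /quad !rmorphD /= !map_polyZ map_polyC map_polyXn map_polyX.
  rewrite FE -mulrA -!quadQ /polyQ !rmorphM rmorphB /=.
  by rewrite map_polyZ map_polyX map_polyC.
rewrite /discE -FQ FQE mulf_eq0 negb_or => /andP[_ disc0].
rewrite (disc6_quintic al0 a10 a20 disc0) -(rmorph_quintic_disc intr).
(* The squared leading coefficient 16 turns [2 ^- 12] into 1 / 256. *)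
have -> : al%:~R * a1%:~R * a2%:~R = 4 :> rat by rewrite -mulrA -!rmorphM lead4.
move: (quintic_disc _ _ _ _ _ _ _ _) => N.
by field.
Qed.

Lemma abs_intr_div (D : rat) (N m : int) (p : nat) :
    0 < m -> D = N%:~R / m%:~R -> `|D| = p%:~R ->
  exists2 q : int, `|q|%N = p & N = m * q.
Proof.
move=> m0 DE DN; have absN : `|N| = m * p%:Z.
  apply: (@intr_inj rat); rewrite intr_norm rmorphM /= -DN DE.
  have mR : 0 < m%:~R :> rat by rewrite ltr0z.
  by rewrite normrM normfV (gtr0_norm mR) mulrC divfK ?gt_eqF.
have [N0 | N0] := lerP 0 N.
  by exists p%:Z; rewrite // -absN ger0_norm.
by exists (- p%:Z); rewrite ?abszN // mulrN -absN ltr0_norm // opprK.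
Qed.

Unset Implicit Arguments.

Theorem theorem6p1 (P Q : {poly int}) :
  P \is monic -> size P = 6%N -> (size Q <= 3)%N ->
  (* E : y^2 + Q(x) y = P(x) describes a smooth projective genus 2 curve *)
  discE (polyQ P) (polyQ Q) != 0 ->
  exactly_two_rational_WP (polyQ P) (polyQ Q) ->
  has_quadratic_WP (polyQ P) (polyQ Q) ->
  globally_minimal (polyQ P) (polyQ Q) ->
  ~ (exists p : nat, [/\ prime p, odd p & `|discE (polyQ P) (polyQ Q)| = p%:R]).
Proof.
move=> P_monic szP szQ disc0 twoWP quadWP _ [p [p_pr p_odd discp]].
pose F : {poly int} := 4 *: P + Q ^+ 2.
have FQ : polyQ F = 4 *: polyQ P + polyQ Q ^+ 2.
  by rewrite /polyQ rmorphD rmorphXn /= map_polyZ.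
have szF : size F = 6%N := size_quintic_model szP szQ.
have szPQ : (size (polyQ P) <= 6)%N by rewrite size_polyQ szP.
have szQQ : (size (polyQ Q) <= 3)%N by rewrite size_polyQ.
have [r rF] := rational_root szPQ szQQ twoWP.
have [A [szA AF Ar]] := quadratic_factor szPQ szQQ quadWP.
rewrite -FQ in rF AF.
have [al [be [a1 [b1 [c1 [a2 [b2 [c2 FE]]]]]]]] := integral_factorization szF rF szA AF (Ar r).
have lead4 := mul_lead_coefs P_monic szP szQ FE.
pose N := quintic_disc al be a1 b1 c1 a2 b2 c2.
have NE : discE (polyQ P) (polyQ Q) = N%:~R / 256 := discE_factorization FQ FE lead4 disc0.
(* The integer [q] is [p] with the sign of the discriminant. *)
have [q qp Nq] := abs_intr_div (m := 256) (p := p) isT NE discp.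
move: {discp disc0 twoWP quadWP NE} p_pr p_odd; rewrite -qp => q_pr q_odd.
by apply: (no_factorization q_pr _ P_monic szP szQ FE Nq); rewrite /evz dvdzE dvdn2 negbK.
Qed.
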